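(* For every integer $\ell \ge 3$, the equation \[ n^\ell+(n+1)^\ell + \cdots + (n+k)^\ell=(n+k+1)^\ell+ \cdots + (n+2k)^\ell \] has no solutions in positive integers $k,n$.
   Context: The left-hand side is the sum of the $\ell$-th powers of the $k+1$ consecutive integers $n,\dots,n+k$; the right-hand side is the sum of the $\ell$-th powers of the $k$ consecutive integers $n+k+1,\dots,n+2k$. *)

(* Defs.v *)
From mathcomp Require Export all_boot.

(* Main.v *)
Require Import Defs.
From mathcomp Require Import all_boot.
From mathcomp Require Import ssralg ssrnum ssrint zify ring.

(** Put [m = n + k], [u = k (k + 1)] and [S_j = 1^j + ... + k^j].  Moving the
    powers below [m] to the right-hand side, the equation becomes
    [m^l = sum over odd j of 2 C(l, j) m^(l - j) S_j], in particular [m] is even.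

    Write [v2(u) = a + 1].  For odd [j >= 3] one has [v2(S_j) = 2 a], so that, if
    [e] is the largest odd number [<= l], the term [j = e] can only be balanced
    2-adically when [e <= 1 + v2(l) + 2 a].  As [2^(a + 1) <= k + 1], this makes
    [k] exponentially large in [l]: [2^l <= l (k + 1)^2].

    On the other hand the terms [j = 1] and [j = 3] dominate, and [D = m - l u]
    is a positive integer with [12 l D] very close to [(l - 1) (l - 2)].  As
    [(l - 1) (l - 2)] is [2] modulo [l], the difference is nonzero and too large
    for the available error term. *)

Import GRing.Theory Num.Theory.

(* Summation over [i < k]: the [S_j] of the header is [psum j k.+1]. *)
Definition psum (j k : nat) := \sum_(i < k) i ^ j.

Lemma psumS j k : psum j k.+1 = psum j k + k ^ j.
Proof. by rewrite /psum big_ord_recr. Qed.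

Lemma psum1 k : 2 * psum 1 k.+1 = k * k.+1.
Proof. by elim: k => [|k IH]; rewrite psumS ?mulnDr ?IH ?/psum ?big_ord0 //; nia. Qed.

Lemma psum3 k : 4 * psum 3 k.+1 = (k * k.+1) ^ 2.
Proof. elim: k => [|k IH]; rewrite psumS ?mulnDr ?IH ?/psum ?big_ord0 //; lia. Qed.

Lemma leq_psumSS j k : psum j.+2 k.+1 <= k ^ 2 * psum j k.+1.
Proof.
rewrite /psum big_distrr /=; apply: leq_sum => i _.
rewrite -(addn2 j) expnD mulnC leq_mul2r leq_sqr -ltnS ltn_ord orbT //.
Qed.

(** * The 2-adic valuation as a relation, false at [n = 0] *)

Definition exact2 (v n : nat) := (2 ^ v %| n) && ~~ (2 ^ v.+1 %| n).

Lemma exact2E v q : exact2 v (2 ^ v * q) = odd q.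
Proof.
by rewrite /exact2 dvdn_mulr //= expnSr dvdn_pmul2l ?expn_gt0 // dvdn2 negbK.
Qed.

Lemma exact2P v n : exact2 v n -> exists2 q, odd q & n = 2 ^ v * q.
Proof.
move=> h; have /andP[/dvdnP[q def_n] _] := h; exists q; last by rewrite mulnC.
by move: h; rewrite def_n mulnC exact2E.
Qed.

Lemma exact2M v w x y : exact2 v x -> exact2 w y -> exact2 (v + w) (x * y).
Proof.
move=> /exact2P[p op ->] /exact2P[q oq ->].
by rewrite mulnACA -expnD exact2E oddM op.
Qed.

Lemma exact2D v x y : 2 ^ v.+1 %| y -> exact2 v (x + y) = exact2 v x.
Proof.
move=> d; rewrite /exact2 !dvdn_addl //.
by apply: dvdn_trans d; rewrite dvdn_exp2l.
Qed.

Lemma exact2_odd q : odd q -> exact2 0 q.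
Proof. by move=> oq; rewrite -[q]mul1n -[1](expn0 2) exact2E. Qed.

(** * 2-adic valuations of power sums *)

Lemma psum_double_odd e r : 0 < e -> odd (psum e r.*2) = odd r.
Proof.
move=> e0; elim: r => [|r IH]; first by rewrite /psum big_ord0.
rewrite doubleS !psumS !oddD IH !oddX /= odd_double eqn0Ngt e0 /=.
by case: (odd r).
Qed.

Lemma expnD_second_order x n e :
  exists y, (x + n) ^ e = x ^ e + n * (e * x ^ e.-1) + n ^ 2 * y.
Proof.
elim: e => [|e [y IH]]; first by exists 0; rewrite !expn0; lia.
exists (e * x ^ e.-1 + (x + n) * y); rewrite expnS IH !expnS /=.
by case: e {IH} => [|e] /=; rewrite ?expnS; nia.
Qed.

(** The upper half of the range is the lower half shifted by [n], and each shifted power is expanded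
    modulo [n ^ 2]. *)
Lemma psum_double e n :
  exists y, psum e (n + n) = 2 * psum e n + n * (e * psum e.-1 n) + n ^ 2 * y.
Proof.
have H p : exists y, \sum_(i < p) (i + n) ^ e
    = psum e p + n * (e * psum e.-1 p) + n ^ 2 * y.
  elim: p => [|p [y IH]]; first by exists 0; rewrite /psum !big_ord0; lia.
  have [z hz] := expnD_second_order p n e.
  by exists (y + z); rewrite big_ord_recr /= IH hz !psumS; nia.
have [y hy] := H n.
exists y; rewrite {1}/psum big_split_ord /= -/(psum e n).
under [X in _ + X]eq_bigr => i _ do rewrite addnC.
by rewrite hy; nia.
Qed.

(** Induction on [b] by doubling: the first term of [psum_double] gains one factor 2, and the others
    are divisible by [2 ^ b.+2], the linear one because [e] is even. *)
Lemma exact2_psum_even e b r : ~~ odd e -> 0 < e -> odd r ->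
  exact2 b (psum e (2 ^ b.+1 * r)).
Proof.
move=> ee e0 odd_r; elim: b => [|b IH].
  by apply: exact2_odd; rewrite expn1 mul2n psum_double_odd.
have [y hy] := psum_double e (2 ^ b.+1 * r).
rewrite [2 ^ b.+2]expnS -mulnA mul2n -addnn hy.
rewrite -addnA exact2D; first by rewrite -[b.+1]add1n exact2M // /exact2.
apply: dvdn_add.
  by rewrite expnSr -mulnA dvdn_mul // mulnA dvdn_mulr // dvdn_mull // dvdn2.
rewrite expnSr dvdn_mulr // -mulnn dvdn_mul ?dvdn_mulr //.
by rewrite expnS dvdn_mulr.
Qed.

(* The second equation only serves to carry the induction. *)
Lemma symmetric_pow_expansion c i s :
  exists z w, (c + i + i) ^ s.*2.+1 + c ^ s.*2.+1
    = (c + i) * (2 * s.*2.+1 * i ^ s.*2) + (c + i) ^ 3 * z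
  /\ (c + i + i) ^ s.*2.+1 = c ^ s.*2.+1 + 2 * i ^ s.*2.+1 + (c + i) ^ 2 * w.
Proof.
elim: s => [|s [z [w [hf hg]]]]; first by exists 0, 0; rewrite /= !expn1; lia.
set n := c + i in hf hg *.
have sqS x : x ^ s.+1.*2.+1 = x ^ 2 * x ^ s.*2.+1 by rewrite -expnD.
have evS : i ^ s.+1.*2 = i * i ^ s.*2.+1 by rewrite -expnS.
(* Here [c] stands for [n - i]. Multiplying the two powers by [(n + i) ^ 2] and [c ^ 2] mixes their
   sum and difference; adding [2 * n * i * A] below avoids subtraction. *)
have hc : c ^ 2 + 2 * n * i = n ^ 2 + i ^ 2 by rewrite /n; ring.
rewrite !sqS evS.
have ev : i ^ s.*2.+1 = i * i ^ s.*2 by rewrite expnS.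
rewrite doubleS; move: (s.*2) ev hf hg => t ev hf hg.
set B := (n + i) ^ t.+1 in hf hg *; set A := c ^ t.+1 in hf hg *.
exists ((n ^ 2 + i ^ 2) * z + 2 * t.+1 * i ^ t + 2 * i * w).
exists ((n ^ 2 + i ^ 2) * w + 2 * i ^ t.+1 + 2 * i * (2 * t.+1 * i ^ t) + 2 * i * n ^ 2 * z).
split; apply/eqP.
  rewrite -(eqn_add2r (2 * n * i * A)); apply/eqP.
  transitivity ((n ^ 2 + i ^ 2) * (B + A) + 2 * n * i * B).
    transitivity ((n + i) ^ 2 * B + (c ^ 2 + 2 * n * i) * A); first ring.
    by rewrite hc; ring.
  by rewrite hf hg ev; ring.
rewrite -(eqn_add2r (2 * n * i * A)); apply/eqP.
transitivity ((n ^ 2 + i ^ 2) * B + 2 * n * i * (B + A)); first ring.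
transitivity ((n ^ 2 + i ^ 2) * A + 2 * i ^ 2 * i ^ t.+1
  + n ^ 2 * ((n ^ 2 + i ^ 2) * w + 2 * i ^ t.+1
    + 2 * i * (2 * t.+1 * i ^ t) + 2 * i * n ^ 2 * z)).
  by rewrite hf hg ev; ring.
by rewrite -{1}hc; ring.
Qed.

(** The even orders of the two binomial expansions cancel and the odd ones double. Orders beyond [l]
    have coefficient [0]. *)
Lemma pow_sym_expansion m i l : i <= m ->
  (m + i) ^ l = (m - i) ^ l
    + \sum_(s < l.+1) 2 * 'C(l, s.*2.+1) * m ^ (l - s.*2.+1) * i ^ s.*2.+1.
Proof.
move=> le_im.
have -> : \sum_(s < l.+1) 2 * 'C(l, s.*2.+1) * m ^ (l - s.*2.+1) * i ^ s.*2.+1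
  = \sum_(j < l.+1) 2 * (odd j * ('C(l, j) * (m ^ (l - j) * i ^ j))).
  pose F j := 2 * ('C(l, j) * (m ^ (l - j) * i ^ j)).
  have H p : \sum_(s < p) F s.*2.+1 = \sum_(j < p.*2) odd j * F j.
    elim: p => [|p IH]; first by rewrite !big_ord0.
    rewrite doubleS !big_ord_recr /= IH odd_double /= mul0n mul1n; lia.
  transitivity (\sum_(s < l.+1) F s.*2.+1).
    by apply: eq_bigr => s _; rewrite /F; ring.
  rewrite H -addnn big_split_ord /= [X in _ + X]big1 ?addn0 => [|j _].
    by apply: eq_bigr => j _; rewrite /F mulnCA.
  by rewrite /F bin_small ?mul0n ?muln0 //; lia.
apply/eqP; rewrite -(eqr_nat int); apply/eqP.
rewrite natrD !natrX natrD natrB // exprDn exprBn natr_sum -big_split /=.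
apply: eq_bigr => j _; rewrite !natrM !natrX -!(mulr_natr (_ * _)%R).
rewrite -signr_odd; case: (odd j) => /=; rewrite ?expr0 ?expr1; ring.
Qed.

(** For [b = 0] parity suffices. Otherwise the range is halved at [n], and pairing [n + i] with
    [n - i] leaves, modulo [n ^ 3], [2 * n * e] times an even power sum of known valuation. *)
Lemma exact2_psum_odd s b r : 0 < s -> odd r ->
  exact2 b.*2 (psum s.*2.+1 (2 ^ b.+1 * r)).
Proof.
move=> s0 odd_r; case: b => [|b].
  by apply: exact2_odd; rewrite expn1 mul2n psum_double_odd.
set n := 2 ^ b.+1 * r; set e := s.*2.+1.
(* The pairs run through [1] to [2 * n - 1] with [n] taken twice, hence the extra [n ^ e]. *)
have [z hz] : exists z, psum e (n + n) + n ^ e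
    = n * (2 * e * psum s.*2 n) + n ^ 3 * z.
  have rev : psum e n + n ^ e = \sum_(i < n) (n - i) ^ e.
    rewrite -psumS /psum big_ord_recl exp0n // add0n (reindex_inj rev_ord_inj).
    by apply: eq_bigr => i _ /=; rewrite /bump /= add1n subnSK.
  have H p : p <= n -> exists z, \sum_(i < p) ((n + i) ^ e + (n - i) ^ e)
      = n * (2 * e * psum s.*2 p) + n ^ 3 * z.
    elim: p => [|p IH] lt_pn; first by exists 0; rewrite /psum !big_ord0; lia.
    have [y hy] := IH (ltnW lt_pn).
    have [z [w [hz _]]] := symmetric_pow_expansion (n - p) p s.
    rewrite subnK ?(ltnW lt_pn) // -/e in hz.
    exists (y + z); rewrite big_ord_recr /= hy hz psumS; ring.
  have [z hz] := H n (leqnn n).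
  exists z; rewrite -hz big_split -rev /= /psum big_split_ord /=; ring.
rewrite [2 ^ b.+2]expnS -mulnA mul2n -/n -[n.*2]addnn.
have d3 : 2 ^ b.+1.*2.+1 %| n ^ 3.
  by rewrite expnMn -expnM dvdn_mulr // dvdn_exp2l //; lia.
rewrite -(@exact2D _ _ (n ^ e)); last first.
  by apply: dvdn_trans d3 _; rewrite dvdn_exp2l // /e; lia.
rewrite hz exact2D; last exact: dvdn_mulr.
rewrite (_ : n * _ = 2 ^ b.+2 * (r * e) * psum s.*2 n); last first.
  by rewrite /n !expnS; ring.
rewrite (_ : b.+1.*2 = b.+2 + b); last by lia.
apply: exact2M; first by rewrite exact2E oddM odd_r /e /= odd_double.
by apply: exact2_psum_even => //; rewrite ?odd_double // double_gt0.
Qed.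

(** * The equation expanded about its middle term *)

Lemma balanced_sums_expansion l k n :
  \sum_(n <= m < n + k + 1) m ^ l = \sum_(n + k + 1 <= m < n + 2 * k + 1) m ^ l ->
  (n + k) ^ l = \sum_(s < l.+1) 2 * 'C(l, s.*2.+1) * (n + k) ^ (l - s.*2.+1)
                                * psum s.*2.+1 k.+1.
Proof.
set m := n + k => eq_sums.
have left_sum : \sum_(n <= i < n + k + 1) i ^ l = \sum_(i < k.+1) (m - i) ^ l.
  rewrite -{1}[n]add0n big_addn (_ : n + k + 1 - n = k.+1); last by lia.
  rewrite big_mkord (reindex_inj rev_ord_inj); apply: eq_bigr => i _ /=.
  by congr (_ ^ _); have := ltn_ord i; rewrite /m; lia.
have right_sum : m ^ l + \sum_(m + 1 <= i < n + 2 * k + 1) i ^ l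
    = \sum_(i < k.+1) (m + i) ^ l.
  rewrite big_ord_recl addn0 -{1}[m + 1]add0n big_addn.
  rewrite (_ : n + 2 * k + 1 - (m + 1) = k) ?big_mkord; last by rewrite /m; lia.
  by congr (_ + _); apply: eq_bigr => i _; congr (_ ^ _); rewrite /= /bump; lia.
apply: (@addIn (\sum_(m + 1 <= i < n + 2 * k + 1) i ^ l)).
rewrite right_sum -eq_sums left_sum addnC.
under [X in _ = _ + X]eq_bigr => s _ do rewrite /psum big_distrr.
rewrite exchange_big -big_split; apply: eq_bigr => i _ /=.
by rewrite pow_sym_expansion //; have := ltn_ord i; rewrite /m; lia.
Qed.

(** * The 2-adic lower bound for [k] *)

(** Here [2 ^ a.+1] is the exact power of two in [N], the even one of [k] and [k.+1]. *)
Lemma two_adic_psum k : 0 < k ->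
  exists a, [/\ 2 ^ a.+1 <= k.+1, 2 ^ a %| psum 1 k.+1
    & forall s, 0 < s -> exact2 a.*2 (psum s.*2.+1 k.+1)].
Proof.
move=> k0; pose N := if odd k then k.+1 else k.
have N0 : 0 < N by rewrite /N; case: ifP.
have eN : ~~ odd N by rewrite /N; case: ifP => /= [->|->].
have leN : N <= k.+1 by rewrite /N; case: ifP.
have [r co_r def_N] := pfactor_coprime (isT : prime 2) N0.
have odd_r : odd r by rewrite -coprime2n.
have : 0 < logn 2 N by rewrite -pfactor_dvdn // expn1 dvdn2.
move: def_N; case: (logn 2 N) => // a; rewrite mulnC => def_N _.
have dN : 2 ^ a.+1 %| N by rewrite def_N dvdn_mulr.
exists a; split => [||s s0].
- by apply: leq_trans leN; apply: dvdn_leq.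
- rewrite -(@dvdn_pmul2l 2) // psum1 -expnS; apply: (dvdn_trans dN).
  by rewrite /N; case: ifP => _; [apply: dvdn_mull | apply: dvdn_mulr].
(* If [N = k], one summand [N ^ s.*2.+1] is left over; its exponent is at least 3, so it does not
   affect the valuation. *)
have -> : psum s.*2.+1 k.+1 = psum s.*2.+1 N + (~~ odd k) * N ^ s.*2.+1.
  by rewrite /N; case: (odd k) => /=; rewrite ?mul0n ?addn0 // mul1n psumS.
rewrite exact2D; last first.
  apply: dvdn_mull; rewrite def_N expnMn -expnM dvdn_mulr // dvdn_exp2l //; nia.
by rewrite def_N exact2_psum_odd.
Qed.

(** Follows from [j * 'C(l, j) = l * 'C(l.-1, j.-1)], as [j] is odd. *)
Lemma dvdn_bin_odd l j : odd j -> 2 ^ logn 2 l %| 'C(l, j).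
Proof.
case: l => [|l]; first by rewrite logn0 dvd1n.
case: j => // j oj.
have co : coprime (2 ^ logn 2 l.+1) j.+1.
  by rewrite coprimeXl // coprime2n.
rewrite -(Gauss_dvdr _ co) -mul_bin_diag.
by rewrite dvdn_mulr // pfactor_dvdnn.
Qed.

Lemma two_adic_lower_bound l k m : 2 < l -> 0 < k -> 0 < m ->
  m ^ l = \sum_(s < l.+1) 2 * 'C(l, s.*2.+1) * m ^ (l - s.*2.+1)
                          * psum s.*2.+1 k.+1 ->
  2 ^ l <= l * k.+1 ^ 2.
Proof.
move=> l2 k0 m0 eqm.
have [a [le_a dvd1 exS]] := two_adic_psum k k0.
have even_m : 2 %| m.
  have : 2 %| m ^ l.
    by rewrite eqm; apply: dvdn_sum => s _; rewrite -!mulnA dvdn_mulr.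
  by rewrite Euclid_dvdX // => /andP[].
pose t := l.-1./2; pose e := t.*2.+1.
have le_el : e <= l <= e.+1 by rewrite /e /t; lia.
have eqm' : m ^ e = \sum_(s < l.+1) 2 * 'C(l, s.*2.+1) * m ^ (e - s.*2.+1)
                                    * psum s.*2.+1 k.+1.
  apply/eqP; rewrite -(@eqn_pmul2l (m ^ (l - e))) ?expn_gt0 ?m0 //.
  rewrite -expnD subnK; last by case/andP: le_el.
  rewrite eqm big_distrr; apply/eqP/eq_bigr => s _ /=.
  have [le_se|lt_es] := leqP s.*2.+1 e; last first.
    by rewrite bin_small ?muln0 ?mul0n ?muln0 //; move: lt_es le_el; rewrite /e; lia.
  rewrite (_ : l - s.*2.+1 = (l - e) + (e - s.*2.+1)) ?expnD; first by ring.
  by move: le_se le_el; rewrite /e; lia.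
pose c := logn 2 l.
have exC : exact2 c 'C(l, e).
  have [def_l|def_l] : l = e \/ l = e.+1 by lia.
    by rewrite {1}def_l binn /c logn_coprime // coprime2n def_l /= odd_double.
  have [r co_r def_r] := pfactor_coprime (isT : prime 2) (ltnW (ltnW l2)).
  by rewrite {1}def_l binSn -def_l def_r mulnC exact2E -coprime2n.
have t_lt : t < l.+1 by rewrite /t; lia.
have t0 : 0 < t by rewrite /t; lia.
(* Otherwise the order [e] term alone has the least valuation, which is below [e], whereas [2 ^ e]
   divides [m ^ e]. *)
have le_e : e <= (c + a.*2).+1.
  rewrite leqNgt; apply/negP => lt_e.
  have : exact2 (c + a.*2).+1 (m ^ e).
    rewrite eqm' (bigD1 (Ordinal t_lt)) //= -/e exact2D.
      rewrite subnn expn0 muln1 -[(_ + _).+1]add1n addnA.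
      by rewrite !exact2M // ?exS.
    apply: dvdn_sum => s ne_st.
    have [lt_ls|le_sl] := ltnP l s.*2.+1; first by rewrite bin_small.
    have {ne_st} ne_st : s != t :> nat by [].
    have lt_se : s.*2.+2 < e by move: ne_st le_sl le_el; rewrite /e /t; lia.
    have dm : 2 ^ (e - s.*2.+1) %| m ^ (e - s.*2.+1) by apply: dvdn_exp2r.
    (* Order 1 only has [a] factors 2 in its power sum; the power [m ^ (e - 1)] makes up for the
       rest. *)
    have dS : 2 ^ (if s == 0 :> nat then a else a.*2) %| psum s.*2.+1 k.+1.
      case: eqP => [->//|/eqP s0]; rewrite -lt0n in s0.
      by have /andP[] := exS s s0.
    have dC := dvdn_bin_odd l s.*2.+1; rewrite /= odd_double /= in dC.
    have := dvdn_mul (dvdn_mul (dvdn_mul (dvdnn 2) (dC isT)) dm) dS.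
    apply: dvdn_trans; rewrite -expnS -!expnD dvdn_exp2l // -/c.
    by move: lt_se lt_e; case: ifP => /eqP; lia.
  rewrite /exact2 => /andP[_ /negP[]].
  by apply: dvdn_trans (dvdn_exp2l 2 lt_e) _; apply: dvdn_exp2r.
have le_cl : 2 ^ c <= l by apply: dvdn_leq; [lia | apply: pfactor_dvdnn].
apply: leq_trans (leq_mul le_cl (_ : 2 ^ (a.+1 * 2) <= _)).
  by rewrite -expnD leq_exp2l //; lia.
by rewrite expnM leq_exp2r.
Qed.

(** * Size of the terms of the expansion *)

Lemma bin_SS l j : j.+2 * j.+1 * 'C(l, j.+2) = (l - j.+1) * (l - j) * 'C(l, j).
Proof. by rewrite -mulnA mulnCA mul_bin_left mulnCA mul_bin_left mulnA. Qed.

(** Half of the order [j] term: the factor 2 is left out. *)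
Definition expansion_term l k m j := 'C(l, j) * m ^ (l - j) * psum j k.+1.

(** Passing from [j] to [j.+2] costs at most a factor [l ^ 2 * k ^ 2 / (20 * m ^ 2)], where
    [20 = 4 * 5] is the least value of [j.+1 * j.+2]. *)
Lemma expansion_term_decay l k m j : 2 < j -> 0 < l -> 0 < k ->
  l * (k * k.+1) <= m ->
  20 * k.+1 ^ 2 * expansion_term l k m j.+2 <= expansion_term l k m j.
Proof.
move=> j2 l0 k0 le_m; rewrite /expansion_term.
have [lt_lj|le_jl] := ltnP l j.+2; first by rewrite bin_small // !mul0n muln0.
have pos : 0 < (l * k) ^ 2 by rewrite expn_gt0 muln_gt0 l0 k0.
rewrite -(leq_pmul2l pos).
set B := 'C(l, j.+2); set Y := m ^ (l - j.+2); set S := psum j.+2 k.+1.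
have -> : m ^ (l - j) = m ^ 2 * Y by rewrite /Y -expnD; congr (_ ^ _); lia.
apply: (@leq_trans (20 * B * (m ^ 2 * Y) * S)).
  rewrite (_ : _ * _ = 20 * B * ((l * (k * k.+1)) ^ 2 * Y) * S); last ring.
  by rewrite !leq_mul // leq_sqr.
apply: (@leq_trans (j.+2 * j.+1 * B * (m ^ 2 * Y) * S)).
  by rewrite !leq_mul //; nia.
rewrite /B bin_SS.
apply: (@leq_trans (l * l * 'C(l, j) * (m ^ 2 * Y) * (k ^ 2 * psum j k.+1))).
  by rewrite !leq_mul ?leq_subr // leq_psumSS.
by apply/eq_leq; ring.
Qed.

Lemma expansion_tail_bound l k m n : 0 < l -> 0 < k -> l * (k * k.+1) <= m ->
  (20 * k.+1 ^ 2 - 1) * \sum_(s < n) expansion_term l k m s.+2.*2.+1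
    <= expansion_term l k m 3.
Proof.
move=> l0 k0 le_m; set T := expansion_term l k m.
(* The next term is kept on the left so that the geometric bound telescopes. *)
suff : (20 * k.+1 ^ 2 - 1) * \sum_(s < n) T s.+2.*2.+1 + T n.+1.*2.+1 <= T 3 by lia.
elim: n => [|n IH]; first by rewrite big_ord0 muln0 add0n.
have := expansion_term_decay l k m n.+1.*2.+1 isT l0 k0 le_m.
rewrite -/T -doubleS big_ord_recr /= mulnDr => hT.
by apply: leq_trans IH; rewrite -!addnA leq_add2l; nia.
Qed.

(** * Arithmetic of the deviation [D] *)

(** Serves to turn [2 ^ l <= l * k.+1 ^ 2] into [l ^ 2 <= 6 * u]. *)
Lemma cube_le_exp2 l : 12 < l -> l ^ 3 <= 3 * 2 ^ l.
Proof.
elim: l => // l IH; rewrite ltnS leq_eqVlt => /orP[/eqP <-//|lt_l].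
have h3 : 13 * l ^ 2 <= l ^ 3 by rewrite [l ^ 3]expnS leq_mul2r lt_l orbT.
have h2 : 13 * l <= l ^ 2 by rewrite -mulnn leq_mul2r lt_l orbT.
rewrite [2 ^ _]expnS (_ : l.+1 ^ 3 = l ^ 3 + 3 * l ^ 2 + 3 * l + 1); last ring.
have := IH lt_l; lia.
Qed.

(** Applied with [Q = 20 * k.+1 ^ 2] and [m = l * u + D]; the relative error allowed is
    [Q / (Q - 1)]. *)
Lemma no_integral_deviation l u Q D :
  0 < l -> 0 < D -> 80 <= Q -> (12 < l -> l ^ 2 <= 6 * u /\ l < Q) ->
  l * (l - 1) * (l - 2) * u ^ 2 <= 12 * D * (l * u + D) ^ 2 ->
  (Q - 1) * (12 * D * (l * u + D) ^ 2) <= Q * (l * (l - 1) * (l - 2) * u ^ 2) ->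
  0 < u -> False.
Proof.
move=> l0 D0 Q80 hl lo up u0.
have up' : (Q - 1) * (12 * D * l) <= Q * ((l - 1) * (l - 2)).
  rewrite -(@leq_pmul2l (l * u ^ 2)) ?muln_gt0 ?l0 ?expn_gt0 ?u0 //.
  apply: leq_trans (_ : _ <= (Q - 1) * (12 * D * (l * u + D) ^ 2)) _.
    rewrite (_ : _ * _ = (Q - 1) * (12 * D * (l * u) ^ 2)); last ring.
    by rewrite !leq_mul ?leq_sqr ?leq_addr.
  by apply: leq_trans up _; apply/eq_leq; ring.
(* For smaller [l], [(l - 1) * (l - 2) <= 10 * l], and the ratio of 12 to 10 exceeds
   [Q / (Q - 1)]. *)
have l13 : 12 < l.
  rewrite ltnNge; apply/negP => l12.
  have P10 : (l - 1) * (l - 2) <= 10 * l by nia.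
  have : (Q - 1) * 12 * l <= Q * 10 * l.
    rewrite -!mulnA; apply: leq_trans (leq_trans up' _); last by rewrite leq_mul.
    by rewrite leq_mul // leq_mul // leq_pmulr.
  by rewrite leq_pmul2r //; lia.
have {hl} [hu lQ] := hl l13.
have le_D : 12 * D + 3 <= l.
  rewrite leqNgt; apply/negP => lt_l.
  have : (Q - 1) * l * (l - 2) <= Q * (l - 1) * (l - 2).
    rewrite -!mulnA; apply: leq_trans up'.
    by rewrite leq_mul2l mulnC leq_mul ?orbT //; lia.
  rewrite leq_pmul2r; last by lia.
  have := leq_pmulr Q l0.
  by rewrite mulnBl mulnBr; lia.
(* As [(l - 1) * (l - 2) = l * (l - 3) + 2], the residue 2 is a guaranteed gap. *)
have z2 : 12 * D * l + 2 <= (l - 1) * (l - 2).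
  have [x def_l] : exists x, l = x + 3 by exists (l - 3); lia.
  have -> : (l - 1) * (l - 2) = l * x + 2.
    have -> : l - 1 = x + 2 by lia.
    have -> : l - 2 = x + 1 by lia.
    by rewrite def_l; ring.
  by rewrite leq_add2r mulnC leq_mul2l; lia.
(* Scaled by [l * u ^ 2], the gap must fit into the lower terms of [12 * D * (l * u + D) ^ 2]; [D2]
   and [D3] show that these are too small. *)
have lead : 2 * (l * u ^ 2) <= 24 * D ^ 2 * (l * u) + 12 * D ^ 3.
  rewrite -(leq_add2l (12 * D * l * (l * u ^ 2))) -mulnDl.
  apply: leq_trans (leq_mul z2 (leqnn _)) _.
  rewrite (_ : _ * _ = l * (l - 1) * (l - 2) * u ^ 2); last ring.
  by apply: leq_trans lo _; apply/eq_leq; ring.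
have D2 : 24 * D ^ 2 <= u.
  have : (12 * D) ^ 2 <= l ^ 2 by rewrite leq_sqr; lia.
  by rewrite expnMn; lia.
have D3 : 12 * D ^ 3 < l * u.
  by rewrite expnS mulnA ltn_mul //; lia.
have := leq_mul D2 (leqnn (l * u)).
have : l * u <= l * u ^ 2 by rewrite leq_mul2l -mulnn leq_pmulr ?orbT.
rewrite (_ : u * (l * u) = l * u ^ 2); last ring.
lia.
Qed.

Theorem theorem1 (l : nat) (hl : 3 <= l) :
  ~ exists k n : nat,
      [/\ 0 < k, 0 < n &
          \sum_(n <= m < n + k + 1) m ^ l
          = \sum_(n + k + 1 <= m < n + 2 * k + 1) m ^ l].
Proof.
case=> k [n [k0 n0 /balanced_sums_expansion]].
have : 0 < n + k by lia.
move: (n + k) => m m0 eqm.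
have adic := two_adic_lower_bound l k m hl k0 m0 eqm.
set u := k * k.+1; set Q := 20 * k.+1 ^ 2.
set T := expansion_term l k m.
pose E := \sum_(s < l.-1) T s.+2.*2.+1.
(* Orders 1 and 3 are split off; [E] collects the orders from 5 on. *)
have {}eqm : m ^ l = 2 * T 1 + 2 * T 3 + 2 * E.
  have el : l.+1 = l.-1.+2 by lia.
  rewrite eqm el !big_ord_recl /= addnA /E [2 * \sum_(s < _) _]big_distrr /=.
  by congr (_ + _ + _); last apply: eq_bigr => s _; rewrite /T /expansion_term !mulnA.
set Y := m ^ (l - 3).
have Y0 : 0 < Y by rewrite expn_gt0 m0.
have u0 : 0 < u by rewrite muln_gt0 k0.
have def_T1 : 2 * T 1 = l * u * m ^ 2 * Y.
  rewrite /T /expansion_term bin1 (_ : m ^ (l - 1) = m ^ 2 * Y); last first.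
    by rewrite /Y -expnD; congr (_ ^ _); lia.
  by rewrite mulnCA psum1 -/u; ring.
have def_T3 : 24 * T 3 = l * (l - 1) * (l - 2) * u ^ 2 * Y.
  have h6 : 6 * 'C(l, 3) = l * (l - 1) * (l - 2).
    by have := bin_SS l 1; rewrite bin1; nia.
  rewrite -h6 /u -psum3 /T /expansion_term -/Y; ring.
have T3_gt0 : 0 < T 3.
  rewrite /T /expansion_term !muln_gt0 bin_gt0 hl expn_gt0 m0 /=.
  by have := psum3 k; rewrite -/u; nia.
have mY : m ^ l = m * m ^ 2 * Y.
  by rewrite -expnS /Y -expnD; congr (_ ^ _); lia.
rewrite def_T1 mY in eqm.
have m2Y : 0 < m ^ 2 * Y by rewrite muln_gt0 expn_gt0 m0.
have lt_m : l * u < m.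
  by rewrite -(ltn_pmul2r m2Y); lia.
have tail : (Q - 1) * E <= T 3.
  by apply: expansion_tail_bound => //; [lia | apply: ltnW].
pose D := m - l * u.
have def_m : m = l * u + D by rewrite subnKC // ltnW.
have DE : D * (m ^ 2 * Y) = 2 * T 3 + 2 * E by rewrite /D mulnBl; lia.
(* [DE] is multiplied by 12, since [24 * T 3] has no denominators, and divided by [Y]; [tail] bounds
   [E]. *)
have [lo up] : l * (l - 1) * (l - 2) * u ^ 2 <= 12 * D * m ^ 2
  /\ (Q - 1) * (12 * D * m ^ 2) <= Q * (l * (l - 1) * (l - 2) * u ^ 2).
  have DE' : 12 * D * m ^ 2 * Y = 24 * T 3 + 24 * E by lia.
  split; rewrite -(leq_pmul2r Y0).
    by rewrite DE' -def_T3 leq_addr.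
  rewrite -mulnA DE' -[Q * _ * Y]mulnA -def_T3 mulnDr.
  have -> : Q * (24 * T 3) = (Q - 1) * (24 * T 3) + 24 * T 3.
    by rewrite -mulSnr subn1 prednK // /Q muln_gt0 expn_gt0.
  by rewrite leq_add2l mulnCA leq_mul2l tail.
apply: (@no_integral_deviation l u Q D); rewrite -?def_m //.
- lia.
- by rewrite subn_gt0.
- by rewrite /Q (@leq_mul 20 4) // (@leq_sqr 2).
- move=> l12; have h3 := cube_le_exp2 l l12.
  have sq_u : k.+1 ^ 2 <= 2 * u.
    by rewrite /u -mulnn mulnA leq_mul2r mul2n -addnn -addn1 leq_add2l k0 orbT.
  have le_u : l ^ 2 <= 6 * u.
    rewrite -(@leq_pmul2l l) -?expnS; last lia.
    apply: leq_trans h3 _; apply: leq_trans (leq_mul (leqnn 3) adic) _.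
    by rewrite mulnCA leq_mul2l; lia.
  have u_sq : u <= k.+1 ^ 2 by rewrite -mulnn leq_mul2r leqnSn orbT.
  have l_sq : l <= l ^ 2 by rewrite -mulnn leq_pmulr; lia.
  by split=> //; rewrite /Q; lia.
Qed.
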